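(* Let $\mathcal{B}$ be an almost greedy basis of a quasi-Banach space $\mathbb{X}$. Then there is a renorming of $\mathbb{X}$ with respect to which $C_{qg}=C_{ag}=\Lambda_u=\Lambda_t=1$.
   Context: The scalar field is $\mathbb{R}$ or $\mathbb{C}$. A quasi-norm satisfies the axioms of a norm except that the triangle inequality is replaced by $\Vert f+g\Vert\le\kappa(\Vert f\Vert+\Vert g\Vert)$ for some $\kappa\ge1$ (it need not be a continuous function); a quasi-Banach space is a vector space complete for the topology of a quasi-norm. A renorming of $(\mathbb{X},\Vert\cdot\Vert)$ is another quasi-norm on $\mathbb{X}$ inducing the same topology, i.e., equivalent to $\Vert\cdot\Vert$. A basis of $\mathbb{X}$ is a sequence $\mathcal{B}=(\mathbf{x}_n)_{n=1}^\infty$ whose closed linear span is $\mathbb{X}$ and for which there is a (unique) sequence $(\mathbf{x}_n^* )_{n=1}^\infty$ in $\mathbb{X}^*$ with $\mathbf{x}_n^*(\mathbf{x}_k)=\delta_{k,n}$. It is $M$-bounded if $\sup_n\Vert\mathbf{x}_n\Vert\,\Vert\mathbf{x}_n^*\Vert<\infty$ and semi-normalized if $0<\inf_n\Vert\mathbf{x}_n\Vert\le\sup_n\Vert\mathbf{x}_n\Vert<\infty$. Put $\mathrm{supp}(f)=\{n:\mathbf{x}_n^*(f)\ne0\}$; for finite $A\subseteq\mathbb{N}$, $S_A(f)=\sum_{n\in A}\mathbf{x}_n^*(f)\mathbf{x}_n$ and $S_{A^c}(f)=f-S_A(f)$. A set $A\subseteq\mathbb{N}$ is a greedy set of $f$ if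 $|\mathbf{x}_k^*(f)|\le|\mathbf{x}_n^*(f)|$ for all $n\in A$, $k\in\mathbb{N}\setminus A$ (an infinite $A$ is a greedy set of $f$ iff $\mathrm{supp}(f)\subseteq A$). An almost greedy basis is an $M$-bounded semi-normalized basis for which there is $C\ge1$ with $\Vert f-S_A(f)\Vert\le C\Vert f-S_B(f)\Vert$ whenever $A$ is a finite greedy set of $f\in\mathbb{X}$ and $B\subseteq\mathbb{N}$ with $|B|\le|A|$; the smallest such $C$ is $C_{ag}$. $C_{qg}$ is the smallest $C$ such that $\Vert S_{A\setminus B}(f)\Vert\le C\Vert f\Vert$ for all $f$ and all finite greedy sets $B\subseteq A$ of $f$. Let $\mathrm{sign}(0)=1$ and $\mathrm{sign}(a)=a/|a|$ for $a\ne0$. For finite $A$, $\mathcal{U}(f,A)=\min_{n\in A}|\mathbf{x}_n^*(f)|\sum_{n\in A}\mathrm{sign}(\mathbf{x}_n^*(f))\mathbf{x}_n$ (zero if $A=\emptyset$) and $\mathcal{T}(f,A)=\mathcal{U}(f,A)+S_{A^c}(f)$; if $A$ is infinite with $\mathrm{supp}(f)\subseteq A$, $\mathcal{U}(f,A)=\mathcal{T}(f,A)=0$. Put $\Lambda_u=\sup\{\Vert\mathcal{U}(f,A)\Vert:A\text{ greedy set of }f,\ \Vert f\Vert\le1\}$ and $\Lambda_t=\sup\{\Vert\mathcal{T}(f,A)\Vert:A\text{ greedy set of }f,\ \Vert f\Vert\le1\}$. All constants are computed with respect to the quasi-norm under consideration. *)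

(* Defs.v *)
From HB Require Import structures.
From mathcomp Require Import all_boot all_order all_algebra.
From mathcomp Require Import all_classical all_reals all_analysis.
From mathcomp Require Import complex.

Set Implicit Arguments.
Unset Strict Implicit.
Unset Printing Implicit Defensive.

Import Order.TTheory GRing.Theory Num.Theory.
Local Open Scope classical_set_scope.
Local Open Scope ring_scope.

Variant scalar_kind := RealScalars | ComplexScalars.

Definition scalar_field (R : realType) (k : scalar_kind) : numFieldType :=
  match k with RealScalars => R | ComplexScalars => R[i] end.

(* On [R[i]] the library norm takes its values in [R[i]] (with zero imaginary
   part); quasi-norms and all constants below take values in [R]. *)
Definition modulus (R : realType) (k : scalar_kind) : scalar_field R k -> R :=
  match k return scalar_field R k -> R with
  | RealScalars => fun a : R => `|a|
  | ComplexScalars => fun z : R[i] => complex.Re `|z|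
  end.

Definition of_real (R : realType) (k : scalar_kind) : R -> scalar_field R k :=
  match k return R -> scalar_field R k with
  | RealScalars => fun a : R => a
  | ComplexScalars => fun a : R => (a%:C)%C
  end.

(* Not [Num.sg], which vanishes at [0]. *)
Definition unit_sign (K : numFieldType) (a : K) : K :=
  if a == 0 then 1 else a / `|a|.

Section QuasiNormedSpaces.
Context {R : realType} {k : scalar_kind} {X : lmodType (scalar_field R k)}.
Implicit Types (N : X -> R) (phi : {scalar X}) (f g : X).

Record quasi_norm N : Prop := QuasiNorm {
  qnorm_ge0 : forall f, 0 <= N f;
  qnorm_eq0 : forall f, N f = 0 -> f = 0;
  qnormZ : forall (a : scalar_field R k) f, N (a *: f) = modulus a * N f;
  qnorm_triangle :
    exists2 kappa : R, 1 <= kappa & forall f g, N (f + g) <= kappa * (N f + N g)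
}.

(* The topology of a quasi-norm is metrizable, so sequences suffice. *)
Definition qnorm_complete N : Prop :=
  forall u : nat -> X,
    (forall e : R, 0 < e -> exists n0 : nat, forall m n,
       (n0 <= m)%N -> (n0 <= n)%N -> N (u m - u n) < e) ->
    exists f : X, forall e : R, 0 < e -> exists n0 : nat, forall n,
       (n0 <= n)%N -> N (u n - f) < e.

Definition quasi_Banach N : Prop := quasi_norm N /\ qnorm_complete N.

Definition renorming N N' : Prop :=
  quasi_norm N' /\
  exists c C : R, [/\ 0 < c, 0 < C & forall f, c * N f <= N' f <= C * N f].

(* The sets [[set g | N (g - f) < d]] form a base of neighbourhoods of [f],
   although they need not be open. *)
Definition qnorm_continuous N phi : Prop :=
  forall f (e : R), 0 < e ->
    exists2 d : R, 0 < d & forall g, N (g - f) < d -> modulus (phi g - phi f) < e.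

Definition dual_norm N phi : \bar R :=
  ereal_sup [set (modulus (phi f))%:E | f in [set f | N f <= 1]].

End QuasiNormedSpaces.

Section Bases.
Context {R : realType} {k : scalar_kind} {X : lmodType (scalar_field R k)}.
Variables (N : X -> R) (x : nat -> X) (xs : nat -> {scalar X}).
Implicit Types (f : X) (A B : set nat) (C : R).

Definition dense_span : Prop :=
  forall f (e : R), 0 < e -> exists (m : nat) (a : nat -> scalar_field R k),
    N (f - \sum_(i < m) a i *: x i) < e.

(* The coordinate functionals [xs], being unique when they exist, are carried
   along as data. *)
Definition space_basis : Prop :=
  [/\ dense_span,
      forall n, qnorm_continuous N (xs n)
    & forall n j, xs n (x j) = (j == n)%:R].

Definition M_bounded : Prop :=
  (ereal_sup (range (fun n => (N (x n))%:E * dual_norm N (xs n))) < +oo)%E.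

Definition semi_normalized : Prop :=
  (0 < ereal_inf (range (fun n => (N (x n))%:E)))%E /\
  (ereal_sup (range (fun n => (N (x n))%:E)) < +oo)%E.

(* [S_A f], used only for finite [A]. *)
Definition coord_sum A f : X := \sum_(n \in A) xs n f *: x n.

Definition greedy_set f A : Prop :=
  forall n j, A n -> ~ A j -> modulus (xs j f) <= modulus (xs n f).

Definition almost_greedy_bound C : Prop :=
  forall f A B, finite_set A -> greedy_set f A -> (B #<= A)%card ->
    N (f - coord_sum A f) <= C * N (f - coord_sum B f).

Definition almost_greedy_basis : Prop :=
  [/\ space_basis, M_bounded, semi_normalized
    & exists2 C, 1 <= C & almost_greedy_bound C].

Definition quasi_greedy_bound C : Prop :=
  forall f A B, finite_set A -> greedy_set f A -> greedy_set f B ->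
    B `<=` A -> N (coord_sum (A `\` B) f) <= C * N f.

Definition smallest_constant (P : set R) C : Prop := P C /\ lbound P C.

Definition is_C_ag : R -> Prop :=
  smallest_constant [set C | 1 <= C /\ almost_greedy_bound C].

Definition is_C_qg : R -> Prop := smallest_constant quasi_greedy_bound.

(* [inf] is a minimum when [A] is finite and nonempty; when [A] is empty the
   sum vanishes. An infinite greedy set of [f] contains the support of [f]
   when the basis is M-bounded and semi-normalized. *)
Definition restricted_truncation f A : X :=
  if `[< finite_set A >] then
    of_real k (inf [set modulus (xs n f) | n in A]) *:
      \sum_(n \in A) unit_sign (xs n f) *: x n
  else 0.

Definition truncation f A : X :=
  if `[< finite_set A >] then restricted_truncation f A + (f - coord_sum A f) else 0.

Definition Lambda_u : \bar R :=
  ereal_sup [set y | exists f A,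
    [/\ greedy_set f A, N f <= 1 & y = (N (restricted_truncation f A))%:E]].

Definition Lambda_t : \bar R :=
  ereal_sup [set y | exists f A,
    [/\ greedy_set f A, N f <= 1 & y = (N (truncation f A))%:E]].

End Bases.

(* Main.v *)
Require Import Defs.
From mathcomp Require Import all_boot all_order all_algebra.
From mathcomp Require Import finmap complex.
From mathcomp Require Import all_classical all_reals all_analysis.

(* Any homogeneous function equivalent to a quasi-norm is a quasi-norm, so it
   suffices to find one that decreases along the operations in the four
   constants. Every one of them (truncations, projections onto differences of
   greedy sets, exchanging [f - S_B f] for [f - S_A f]) is a "greedy step": keep
   [f] on the difference of two nested greedy sets [a] and [b], and add a vector
   supported on at most [|b|] further coordinates with coefficients at most
   [min_b |f|]. Greedy steps compose to greedy steps, and a single step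
   increases the given quasi-norm [N] by a bounded factor only, by almost
   greediness. Hence [N' f], the supremum of [N g] over all [g] reached from [f]
   by a greedy step, is the required renorming. *)

Set Implicit Arguments.
Unset Strict Implicit.
Unset Printing Implicit Defensive.

Import Order.TTheory GRing.Theory Num.Theory.
Local Open Scope classical_set_scope.
Local Open Scope ring_scope.

(** * Finite sets of indices *)

Lemma fresh_fset (A : {fset nat}) (n : nat) :
  exists2 E : {fset nat}, #|` E| = n & forall i, i \in E -> i \notin A.
Proof.
elim: n => [|n [E cardE AE]]; first by exists fset0%fset; rewrite ?cardfs0.
pose e := (\max_(i <- (A `|` E)%fset) i).+1.
have eAE : e \notin (A `|` E)%fset.
  apply/negP => eAE.
  by have /bigmax_leqP_seq/(_ e eAE isT) := leqnn e.-1; rewrite ltnn.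
move: eAE; rewrite in_fsetU negb_or => /andP[eA eE].
exists (e |` E)%fset; first by rewrite cardfsU1 eE cardE.
by move=> i; rewrite in_fset1U => /orP[/eqP->|/AE].
Qed.

Lemma card_le_fset (A B : {fset nat}) :
  ([set` A] #<= [set` B])%card <-> (#|` A| <= #|` B|)%N.
Proof.
have AI : ([set` A] #= `I_#|` A|)%card by apply/card_eq_fsetP.
have BI : ([set` B] #= `I_#|` B|)%card by apply/card_eq_fsetP.
by rewrite (card_le_eql AI) (card_le_eqr BI) card_le_II.
Qed.

(** * The real-valued modulus on either scalar field *)

Section Modulus.
Context {R : realType} {k : scalar_kind}.
Implicit Types a b : scalar_field R k.

Lemma of_real_modulus a : of_real k (modulus a) = `|a|.
Proof. by case: k a => [//|a]; rewrite /modulus /of_real normc_def. Qed.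

Lemma of_real_inj : injective (@of_real R k).
Proof. by case: k => //=; exact: complexI. Qed.

Lemma of_realM (s t : R) : of_real k (s * t) = of_real k s * of_real k t.
Proof. by case: k => //=; rewrite rmorphM. Qed.

Lemma modulus_ge0 a : 0 <= modulus a.
Proof.
by case: k a => [a|a]; rewrite /modulus ?normr_ge0// normc_def sqrtr_ge0.
Qed.

Lemma modulus_of_real (t : R) : 0 <= t -> modulus (of_real k t) = t.
Proof.
move=> t0; case: k; rewrite /modulus /of_real; first exact: ger0_norm.
by rewrite normc_def /= expr0n addr0 sqrtr_sqr ger0_norm.
Qed.

Lemma modulusM a b : modulus (a * b) = modulus a * modulus b.
Proof. by apply: of_real_inj; rewrite of_realM !of_real_modulus normrM. Qed.

Lemma of_real0 : of_real k 0 = 0 :> scalar_field R k.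
Proof. by case: k. Qed.

Lemma of_real1 : of_real k 1 = 1 :> scalar_field R k.
Proof. by case: k. Qed.

Lemma modulus0 : modulus (0 : scalar_field R k) = 0.
Proof. by rewrite -of_real0 modulus_of_real. Qed.

Lemma modulus1 : modulus (1 : scalar_field R k) = 1.
Proof. by rewrite -of_real1 modulus_of_real. Qed.

Lemma modulus_le0 a : modulus a <= 0 -> a = 0.
Proof.
move=> a0; apply/eqP; rewrite -normr_eq0 -of_real_modulus -of_real0.
by apply/eqP; congr of_real; apply/le_anti; rewrite a0 modulus_ge0.
Qed.

Lemma modulus_gt0 a : a != 0 -> 0 < modulus a.
Proof.
move=> a0; rewrite lt_neqAle modulus_ge0 andbT eq_sym.
by apply: contra_neq a0 => a0; apply: modulus_le0; rewrite a0.
Qed.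

Lemma modulusV a : modulus a^-1 = (modulus a)^-1.
Proof.
have [->|a0] := eqVneq a 0; first by rewrite invr0 modulus0 invr0.
have m0 : modulus a != 0 by rewrite gt_eqF ?modulus_gt0.
by apply: (mulfI m0); rewrite -modulusM !divff// modulus1.
Qed.

Lemma modulus_unit_sign a : modulus (unit_sign a) = 1.
Proof.
rewrite /unit_sign; case: eqVneq => [_|a0]; first exact: modulus1.
apply: of_real_inj; rewrite of_real_modulus normrM normfV normr_id divff ?normr_eq0//.
by rewrite of_real1.
Qed.

End Modulus.

(** * Coordinates of finite sums under biorthogonality *)

Section Coordinates.
Context {R : realType} {k : scalar_kind} {X : lmodType (scalar_field R k)}.
Context {x : nat -> X} {xs : nat -> {scalar X}}.
Hypothesis biorth : forall n j, xs n (x j) = (j == n)%:R.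
Implicit Types (f g : X) (A B : {fset nat}).

Lemma coef_lincomb A (c : nat -> scalar_field R k) n :
  xs n (\sum_(i <- A) c i *: x i) = if n \in A then c n else 0.
Proof.
rewrite linear_sum; under eq_bigr do rewrite linearZ_LR biorth /=.
case: ifPn => nA; last first.
  rewrite big_seq big1// => i iA; case: eqVneq => [ni|_]; rewrite ?mulr0//.
  by rewrite -ni iA in nA.
rewrite (bigD1_seq n) ?fset_uniq//= eqxx mulr1 big1 ?addr0// => i /negbTE->.
by rewrite mulr0.
Qed.

Lemma coord_sumE A f : coord_sum x xs [set` A] f = \sum_(i <- A) xs i f *: x i.
Proof. by rewrite /coord_sum fsbig_finite ?set_fsetK//; exact: finite_fset. Qed.

Lemma coef_coord_sum A f n :
  xs n (coord_sum x xs [set` A] f) = if n \in A then xs n f else 0.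
Proof. by rewrite coord_sumE coef_lincomb. Qed.

End Coordinates.

(** * Greedy steps, described by coordinates alone *)

Section GreedyStep.
Context {R : realType} {k : scalar_kind} {X : lmodType (scalar_field R k)}.
Context (xs : nat -> {scalar X}) (f g : X) (a : set nat) (b s : {fset nat}).

(* The second alternative of [gs_tail] covers the operations that keep the whole
   tail of [f], with [a = setT]. It does not ask for [a = setT], because
   composing two such steps removes from [a] finitely many points at which [f]
   vanishes. *)
Record greedy_step : Prop := GreedyStep {
  gs_tail : finite_set a \/ forall n, ~ a n -> xs n f = 0;
  gs_sub : [set` b] `<=` a;
  gs_greedya : greedy_set xs f a;
  gs_greedyb : greedy_set xs f [set` b];
  gs_card : (#|` s| <= #|` b|)%N;
  gs_le : forall n j, n \in s -> j \in b -> modulus (xs n g) <= modulus (xs j f);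
  gs_disjoint : forall n, n \in s -> n \notin b -> a n -> xs n f = 0;
  gs_on : forall n, n \notin s -> n \notin b -> a n -> xs n g = xs n f;
  gs_off : forall n, n \notin s -> n \in b \/ ~ a n -> xs n g = 0
}.

End GreedyStep.

(** * Reachability by one greedy step: scaling and composition *)

Section Reach.
Context {R : realType} {k : scalar_kind} {X : lmodType (scalar_field R k)}.
Context (xs : nat -> {scalar X}).
Implicit Types (f g h : X).

Definition greedy_reach f g := exists a b s, greedy_step xs f g a b s.

Lemma greedy_reach_refl f : greedy_reach f f.
Proof.
exists setT, fset0, fset0; split=> //; first by right=> n /(_ I).
by move=> n _ [|/(_ I)].
Qed.

(** All three sets are empty. This covers infinite greedy sets, whose truncations are 0 by
    convention, and degenerate compositions. *)
Lemma greedy_reach_coef0 f g : (forall n, xs n g = 0) -> greedy_reach f g.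
Proof. by move=> g0; exists set0, fset0, fset0; split=> //; left; exact: finite_set0. Qed.

Lemma greedy_reachZ (c : scalar_field R k) f g :
  greedy_reach f g -> greedy_reach (c *: f) (c *: g).
Proof.
have greedyZ A : greedy_set xs f A -> greedy_set xs (c *: f) A.
  move=> gA n j nA jA; rewrite !linearZ /= !modulusM.
  by rewrite ler_wpM2l ?modulus_ge0//; exact: gA.
case=> [a [b [s [tail ba ga gb card le disj on off]]]].
exists a, b, s; split=> //; try exact: greedyZ.
- by case: tail => [|fa]; [left|right=> n an; rewrite linearZ /= fa// mulr0].
- move=> n j ns jb; rewrite !linearZ /= !modulusM ler_wpM2l ?modulus_ge0//.
  exact: le.
- by move=> n ns nb an; rewrite linearZ /= disj// mulr0.
- by move=> n ns nb an; rewrite !linearZ /= on.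
- by move=> n ns nba; rewrite linearZ /= off// mulr0.
Qed.

(** Off [s] a coordinate of [g] is 0 or an unchanged coordinate of [f] outside the greedy set [b],
    so the bound [gs_le] extends to every [n]. *)
Lemma greedy_step_le f g a b s n j :
  greedy_step xs f g a b s -> j \in b -> modulus (xs n g) <= modulus (xs j f).
Proof.
case=> tail ba ga gb card le disj on off jb.
have [ns|ns] := boolP (n \in s); first exact: le.
have [nb|nb] := boolP (n \in b).
  by rewrite off//; [rewrite modulus0 modulus_ge0|left].
have [an|an] := pselect (a n).
  by rewrite on//; apply: gb => //; exact/negP.
by rewrite off//; [rewrite modulus0 modulus_ge0|right].
Qed.

(** Points of [b'] outside [s] carry coordinates of [f] and enlarge the removed set; those inside
    [s] were filled by the first step, and erasing them frees room for [s']. *)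
Lemma greedy_reach_trans f g h :
  greedy_reach f g -> greedy_reach g h -> greedy_reach f h.
Proof.
case=> [a [b [s fg]]] [a' [b' [s' gh]]].
(* A greedy set of [g] on which [g] vanishes somewhere forces [h] to vanish. *)
have [[n nb' gn0]|nz] := pselect (exists2 n, n \in b' & xs n g = 0).
  apply: greedy_reach_coef0 => j; apply: modulus_le0.
  by rewrite (le_trans (greedy_step_le j gh nb'))// gn0 modulus0.
have gf := greedy_step_le _ fg.
case: fg => tail ba ga gb card le disj on off.
case: gh => tail' ba' ga' gb' card' le' disj' on' off'.
(* Since [g] does not vanish on [b'], a point of [b'] outside [s] carries an unchanged coordinate of
   [f]. *)
have b'P n : n \in b' -> n \notin s -> a n /\ n \notin b.
  move=> nb' ns; split; [apply: contrapT => an|apply/negP => nb].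
    by apply: nz; exists n => //; apply: off => //; right.
  by apply: nz; exists n => //; apply: off => //; left.
pose B := (b `|` (b' `\` s))%fset; pose S := (s' `|` (s `\` b'))%fset.
(* Points of [s] outside [b] are dropped, harmlessly since [f] vanishes at those lying in [a]; [b]
   is put back in full so that [B] lies in [A]. *)
pose A := [set n | n \in b \/ [/\ a n, a' n & n \notin s]].
have inB n : (n \in B) = (n \in b) || ((n \notin s) && (n \in b')).
  by rewrite /B in_fsetU in_fsetD.
have inS n : (n \in S) = (n \in s') || ((n \notin b') && (n \in s)).
  by rewrite /S in_fsetU in_fsetD.
(* Each case has its own source of greediness for [A]: the zero coordinate, [ga], or [ga'] at a
   point where [g] and [f] agree. *)
have AP n : ~ A n -> xs n f = 0 \/ ~ a n \/ [/\ a n, ~ a' n, n \notin s & n \notin b].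
  move=> An; have [an|an] := pselect (a n); last by right; left.
  have nb : n \notin b by apply/negP => nb; apply: An; left.
  have [ns|ns] := boolP (n \in s); first by left; exact: disj.
  by right; right; split=> // a'n; apply: An; right.
exists A, B, S; split.
- have finA : finite_set (a `&` a') -> finite_set A.
    move=> faa'; apply: (@sub_finite_set _ _ ([set` b] `|` (a `&` a'))).
      by move=> n [nb|[an a'n _]]; [left|right].
    by rewrite finite_setU; split.
  case: tail => [fa|f0]; first by left; apply: finA; exact: finite_setIl.
  case: tail' => [fa'|g0]; first by left; apply: finA; exact: finite_setIr.
  right=> n /AP[//|[/f0//|[an a'n ns nb]]].
  by rewrite -on// g0.
- move=> n /=; rewrite inB => /orP[nb|/andP[ns nb']]; first by left.
  by right; split=> //; [have [] := b'P _ nb' ns|exact: ba'].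
- move=> n j An Aj.
  have bj : ~ [set` b] j by move=> bj; apply: Aj; left.
  case: An => [nb|[an a'n ns]]; first exact: gb.
  have [nb|nb] := boolP (n \in b); first exact: gb.
  case: (AP _ Aj) => [->|[aj|[aj a'j js jb]]]; [|exact: ga|].
    by rewrite modulus0 modulus_ge0.
  by rewrite -!on//; exact: ga'.
- move=> n j /=; rewrite !inB => nB /negP; rewrite negb_or negb_and negbK => /andP[jb jsb'].
  have bj : ~ [set` b] j by exact/negP.
  case/orP: nB => [nb|/andP[ns nb']]; first exact: gb.
  have [an nb] := b'P _ nb' ns.
  have [aj|aj] := pselect (a j); last exact: ga.
  have [js|js] := boolP (j \in s); first by rewrite disj// modulus0 modulus_ge0.
  by rewrite -!on//; apply: gb' => //; apply/negP; move: jsb'; rewrite (negbTE js).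
- have b's : [disjoint b & b' `\` s]%fset.
    apply/fdisjointP => n nb; rewrite in_fsetD; apply/negP => /andP[ns nb'].
    by have [_] := b'P _ nb' ns; rewrite nb.
  have /eqP -> : #|` B| == (#|` b| + #|` (b' `\` s)%fset|)%N.
    by rewrite (leq_card_fsetU b (b' `\` s)%fset).
  (* The count is |s'| + |s \ b'| <= |b'| + |s \ b'| = |b' \ s| + |s| <= |b' \ s| + |b|. *)
  rewrite (leq_trans (leq_card_fsetU _ _))//.
  rewrite (leq_trans (leq_add card' (leqnn _)))//.
  rewrite -(cardfsID s b') addnAC leq_add2r -(leq_add2l 0) add0n.
  by rewrite fsetIC cardfsID.
- move=> n j; rewrite inS inB => nS jB.
  have hgn i : i \in b' -> i \notin s -> modulus (xs i g) = modulus (xs i f).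
    by move=> ib' iS; have [ai nb] := b'P _ ib' iS; rewrite on.
  have [ns'|ns'] := boolP (n \in s').
    case/orP: jB => [jb|/andP[js jb']]; last by rewrite -hgn//; exact: le'.
    (* [b'] is nonempty because [s'] is, and any [i] in it links the two bounds: [h] at [n] is at
       most [g] at [i], which is at most [f] at [j], in modulus. *)
    have [i ib'] : exists i, i \in b'.
      apply/fset0Pn; rewrite -cardfs_gt0 (leq_trans _ card')// cardfs_gt0.
      by apply/fset0Pn; exists n.
    by rewrite (le_trans (le' _ _ ns' ib'))// gf.
  move: nS; rewrite (negbTE ns') /= => /andP[nb' ns].
  have hgn' : modulus (xs n h) <= modulus (xs n g).
    have [a'n|a'n] := pselect (a' n); first by rewrite on'.
    by rewrite off' ?modulus0 ?modulus_ge0//; right.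
  rewrite (le_trans hgn')//.
  case/orP: jB => [jb|/andP[js jb']]; first exact: gf.
  by rewrite -hgn//; apply: gb' => //; exact/negP.
- move=> n; rewrite inS inB negb_or negb_and negbK => nS /andP[nb nsb'].
  case=> [nb0|[an a'n ns]]; first by rewrite nb0 in nb.
  move: nS nsb'; rewrite (negbTE ns) andbF orbF /= => ns' nb'.
  by rewrite -on//; exact: disj'.
- move=> n; rewrite inS inB !negb_or !negb_and !negbK.
  move=> /andP[ns' nsb'] /andP[nb nsb]; case=> [nb0|[an a'n ns]]; first by rewrite nb0 in nb.
  rewrite (negbTE ns) /= in nsb.
  by rewrite on'// on.
- move=> n; rewrite inS inB negb_or negb_and negbK => /andP[ns' nsb'] nA.
  have [nb'|nb'] := boolP (n \in b'); first by apply: off' => //; left.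
  rewrite (negbTE nb') /= andbF orbF in nsb' nA.
  have [a'n|a'n] := pselect (a' n); last by apply: off' => //; right.
  rewrite on'//; apply: off => //.
  case: nA => [|An]; first by left.
  have [nb|nb] := boolP (n \in b); [by left|right=> an].
  by apply: An; right.
Qed.

End Reach.

(** * Bounds in the given quasi-norm from almost greediness *)

Section AlmostGreedy.
Context {R : realType} {k : scalar_kind} {X : lmodType (scalar_field R k)}.
Context {N : X -> R} {x : nat -> X} {xs : nat -> {scalar X}}.
Context {kappa C : R}.
Hypothesis qnN : quasi_norm N.
Hypothesis kappa_ge1 : 1 <= kappa.
Hypothesis triangleN : forall f g, N (f + g) <= kappa * (N f + N g).
Hypothesis biorth : forall n j, xs n (x j) = (j == n)%:R.
Hypothesis denseN : dense_span N x.
Hypothesis C_ge1 : 1 <= C.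
Hypothesis agN : almost_greedy_bound N x xs C.
Implicit Types (f g u w : X) (A B E : {fset nat}).

Local Notation S A f := (coord_sum x xs [set` A] f).

Let C_ge0 : 0 <= C. Proof. exact: le_trans C_ge1. Qed.
Let kappa_ge0 : 0 <= kappa. Proof. exact: le_trans kappa_ge1. Qed.

Lemma qnorm0 : N 0 = 0.
Proof. by rewrite -(scale0r 0) (qnormZ qnN) modulus0 mul0r. Qed.

Lemma qnormN f : N (- f) = N f.
Proof.
rewrite -scaleN1r (qnormZ qnN) [modulus _](_ : _ = 1) ?mul1r//.
by apply: (of_real_inj (k := k)); rewrite of_real_modulus normrN1 of_real1.
Qed.

Lemma qnorm_triangleB f g : N (f - g) <= kappa * (N f + N g).
Proof. by rewrite -(qnormN g) triangleN. Qed.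

Lemma ag_fset f A B : greedy_set xs f [set` A] -> (#|` B| <= #|` A|)%N ->
  N (f - S A f) <= C * N (f - S B f).
Proof.
by move=> gA BA; apply: agN => //; exact/card_le_fset.
Qed.

Lemma coord_sum0 f : S fset0 f = 0.
Proof. by rewrite coord_sumE big_seq_fset0. Qed.

Lemma ag_residual f A : greedy_set xs f [set` A] -> N (f - S A f) <= C * N f.
Proof.
by move=> gA; have := @ag_fset f A fset0 gA; rewrite coord_sum0 subr0 cardfs0; apply.
Qed.

(* If [p] is a finite sum close to [f], its support is a greedy set of [f - p]
   and removing it gives back [f]. *)
Lemma coef_eq0 f : (forall n, xs n f = 0) -> f = 0.
Proof.
move=> f0; apply: (qnorm_eq0 qnN); apply/eqP; rewrite eq_le (qnorm_ge0 qnN) andbT.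
rewrite leNgt; apply/negP => Nf.
have C0 : 0 < C by exact: lt_le_trans C_ge1.
have [m [a]] := denseN f (divr_gt0 Nf C0).
rewrite (fsbig_ord _ _ (fun i => a i *: x i)) fsbig_finite//.
set A := fset_set _; set p := \sum_(i <- A) _ => Np.
have coefp n : xs n (f - p) = if n \in A then - a n else 0.
  by rewrite linearB /= f0 coef_lincomb// sub0r; case: ifP; rewrite ?oppr0.
have gA : greedy_set xs (f - p) [set` A].
  by move=> n j _ /negP/negbTE jA; rewrite [X in modulus X <= _]coefp jA modulus0 modulus_ge0.
have SA : S A (f - p) = - p.
  rewrite coord_sumE -[RHS]sumrN; apply: eq_big_seq => i iA.
  by rewrite coefp iA scaleNr.
(* This gives [N f <= C * N (f - p)], against the tolerance [N f / C] chosen for [p]. *)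
have := ag_residual gA; rewrite SA opprK subrK leNgt => /negP; apply.
by rewrite mulrC -ltr_pdivlMr.
Qed.

Lemma coef_inj f g : (forall n, xs n f = xs n g) -> f = g.
Proof.
by move=> fg; apply/subr0_eq/coef_eq0 => n; rewrite linearB /= fg subrr.
Qed.

Lemma qnorm_greedy_sum f A : greedy_set xs f [set` A] ->
  N (S A f) <= kappa * (1 + C) * N f.
Proof.
move=> gA; rewrite -[S A f](subKr f) (le_trans (qnorm_triangleB _ _))//.
rewrite -mulrA mulrDl mul1r ler_wpM2l// lerD2l; exact: ag_residual.
Qed.

(* Almost greediness of [w + u], with greedy set [A] and competitor [B]. *)
Lemma qnorm_disjoint_swap w u A B : (#|` B| <= #|` A|)%N ->
  (forall n, n \in A -> n \notin B) ->
  (forall n, n \notin A -> xs n w = 0) ->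
  (forall n, n \notin B -> xs n u = 0) ->
  (forall n j, n \in B -> j \in A -> modulus (xs n u) <= modulus (xs j w)) ->
  N u <= C * N w.
Proof.
move=> BA AB wA uB uw.
have gA : greedy_set xs (w + u) [set` A].
  move=> n j /= nA /negP jA; rewrite !linearD /= (wA j)// add0r (uB n) ?AB// addr0.
  by have [jB|/uB->] := boolP (j \in B); [exact: uw|rewrite modulus0 modulus_ge0].
have := ag_fset gA BA.
rewrite (_ : w + u - _ = u).
  rewrite (_ : w + u - _ = w)//.
  apply: coef_inj => n; rewrite linearB linearD /= coef_coord_sum// linearD /=.
  case: ifPn => [nB|/uB->]; last by rewrite addr0 subr0.
  by rewrite subrr wA//; apply: contraTN nB; exact: AB.
apply: coef_inj => n; rewrite linearB linearD /= coef_coord_sum// linearD /=.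
case: ifPn => [nA|/wA->]; last by rewrite add0r subr0.
by rewrite subrr uB// AB.
Qed.

(* Disjointness is obtained by passing through a flat vector supported away
   from both sets. *)
Lemma qnorm_swap w u A B : (#|` B| <= #|` A|)%N ->
  (forall n, n \notin A -> xs n w = 0) ->
  (forall n, n \notin B -> xs n u = 0) ->
  (forall n j, n \in B -> j \in A -> modulus (xs n u) <= modulus (xs j w)) ->
  N u <= C ^+ 2 * N w.
Proof.
move=> BA wA uB uw.
have [E cardE EAB] := fresh_fset (A `|` B)%fset #|` A|.
have {EAB} EAB n : n \in E -> (n \notin A) && (n \notin B).
  by move=> /EAB; rewrite in_fsetU negb_or.
(* The height [t] is the largest modulus of [u] on [B], or 0 if [B] is empty; it dominates [u] on
   [B] and stays below [w] on [A]. The comparisons of [u] with [v] and of [v] with [w] cost a factor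
   [C] each. *)
pose t : R := \big[Num.max/0]_(n <- B) modulus (xs n u).
have t_ge0 : 0 <= t by exact: bigmax_ge_id.
pose v := \sum_(n <- E) of_real k t *: x n.
have coefv n : xs n v = if n \in E then of_real k t else 0 by exact: coef_lincomb.
have v0 n : n \notin E -> xs n v = 0 by rewrite coefv => /negbTE->.
rewrite expr2 -mulrA.
have uv : N u <= C * N v.
  apply: (@qnorm_disjoint_swap v u E B) => //; first by rewrite cardE.
    by move=> n /EAB/andP[].
  move=> n j nB jE; rewrite (coefv j) jE modulus_of_real//.
  exact: (le_bigmax_seq _ _ predT (fun n => modulus (xs n u))) nB isT.
apply: (le_trans uv); rewrite ler_wpM2l//.
apply: (@qnorm_disjoint_swap w v A E) => //; first by rewrite cardE.
  by move=> n nA; apply/negP => /EAB; rewrite nA.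
move=> n j nE jA; rewrite (coefv n) nE modulus_of_real// /t big_seq.
by apply: bigmax_le => [|i iB]; [exact: modulus_ge0|exact: uw].
Qed.

(** Split [g] into its part on [s], which the swap compares with the projection of [f] on [b], and
    the rest [w], which is made of greedy residuals of [f]. *)
Lemma qnorm_greedy_step f g a b s : greedy_step xs f g a b s ->
  N g <= kappa * (C ^+ 2 * (kappa * (1 + C)) + kappa * (1 + C + C)) * N f.
Proof.
case=> tail ba ga gb card le disj on off.
have Nf0 := qnorm_ge0 qnN f.
pose w := g - S s g.
have Nu : N (S s g) <= C ^+ 2 * (kappa * (1 + C)) * N f.
  rewrite -mulrA; apply: (@le_trans _ _ (C ^+ 2 * N (S b f))).
    apply: (@qnorm_swap _ _ b s) => // [n nb|n ns|n j ns jb];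
      rewrite ?coef_coord_sum// ?(negbTE nb) ?(negbTE ns) ?ns ?jb //.
    exact: le.
  by rewrite ler_wpM2l ?exprn_ge0//; exact: qnorm_greedy_sum.
(* At points of [a] in [s] but not in [b] the value 0 agrees with [f], by [gs_disjoint]; so [w] is
   [f] restricted to [a] minus [b]. *)
have coefw n : xs n w = if (n \in b) || (n \in s) || ~~ `[< a n >] then 0 else xs n f.
  rewrite /w linearB /= coef_coord_sum//.
  case: (boolP (n \in s)) => ns; first by rewrite orbT subrr.
  rewrite orbF subr0; case: (boolP (n \in b)) => nb /=; first by rewrite off//; left.
  by case: asboolP => an /=; [exact: on|apply: off => //; right].
(* One constant serves both tails: a difference of two residuals when [a] is finite, a single
   residual when [f] vanishes off [a]. *)
have Nw : N w <= kappa * (1 + C + C) * N f.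
  case: tail => [fa|fa].
    have -> : w = (f - S b f) - (f - S (fset_set a) f).
      apply: coef_inj => n; rewrite coefw !linearB /= !coef_coord_sum//.
      rewrite in_fset_set// -[n \in a]/(`[< a n >]).
      have [bn|nb] /= := boolP (n \in b).
        by rewrite asboolT ?subrr ?subr0//; exact: ba.
      rewrite subr0; case: asboolP => an /=; last by rewrite orbT subr0 subrr.
      rewrite orbF subrr subr0; case: ifP => // ns; by rewrite disj.
    rewrite (le_trans (qnorm_triangleB _ _))// -mulrA ler_wpM2l//.
    have ga' : greedy_set xs f [set` fset_set a] by rewrite fset_setK.
    have := ag_residual ga'; have := ag_residual gb.
    by move=> h1 h2; rewrite !mulrDl mul1r -addrA (le_trans (lerD h1 h2))// lerDr.
  have -> : w = f - S b f.
    apply: coef_inj => n; rewrite coefw !linearB /= !coef_coord_sum//.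
    have [bn|nb] /= := boolP (n \in b); first by rewrite subrr.
    rewrite subr0; case: asboolP => an /=; last by rewrite orbT fa.
    by rewrite orbF; case: ifP => // ns; rewrite disj.
  rewrite (le_trans (ag_residual gb))// ler_wpM2r//.
  by rewrite (le_trans _ (ler_peMl _ kappa_ge1)) ?addr_ge0// lerDr ?addr_ge0.
rewrite -[g](subrK (S s g)) -mulrA (le_trans (triangleN _ _))// ler_wpM2l//.
by rewrite mulrDl addrC lerD.
Qed.

End AlmostGreedy.

(** * The operations behind the four constants are greedy steps *)

Section Operations.
Context {R : realType} {k : scalar_kind} {X : lmodType (scalar_field R k)}.
Context {x : nat -> X} {xs : nat -> {scalar X}}.
Hypothesis biorth : forall n j, xs n (x j) = (j == n)%:R.
Implicit Types (f g : X) (A B : set nat).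

Lemma greedy_reach_coord_sum f A B : finite_set A ->
  greedy_set xs f A -> greedy_set xs f B -> B `<=` A ->
  greedy_reach xs f (coord_sum x xs (A `\` B) f).
Proof.
move=> fA gA gB BA; have fB := sub_finite_set BA fA.
have coefg n : xs n (coord_sum x xs (A `\` B) f) =
    if (n \in A) && (n \notin B) then xs n f else 0.
  have fAB : finite_set (A `\` B) by exact: finite_setD.
  by rewrite -(fset_setK fAB) coef_coord_sum// in_fset_set// in_setD.
exists A, (fset_set B), fset0; rewrite /= ?fset_setK//.
split; rewrite ?fset_setK//; first by left.
- by move=> n _; rewrite in_fset_set// coefg => -> /mem_set ->.
- move=> n _; rewrite in_fset_set// coefg => -[->|An]; first by rewrite andbF.
  by rewrite (memNset An).
Qed.

(** The step erases [A \ B], where the starting vector agrees with [f], and restores [f] on [B \ A],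
    which is no larger because [B] is no larger than [A]. Elsewhere the two vectors agree. *)
Lemma greedy_reach_almost_greedy f A B : finite_set A ->
  greedy_set xs f A -> (B #<= A)%card ->
  greedy_reach xs (f - coord_sum x xs B f) (f - coord_sum x xs A f).
Proof.
move=> fA gA BA; have fB := card_le_finite BA fA.
case/finite_fsetP: fA gA BA => {}A -> gA; case/finite_fsetP: fB => {}B ->.
move=> /card_le_fset BA.
have coefs n (E : {fset nat}) :
    xs n (f - coord_sum x xs [set` E] f) = if n \in E then 0 else xs n f.
  by rewrite linearB /= coef_coord_sum//; case: ifP; rewrite ?subrr ?subr0.
exists setT, (A `\` B)%fset, (B `\` A)%fset; split=> //.
- by right=> n /(_ I).
- move=> n j /=; rewrite in_fsetD => /andP[nB nA] /negP; rewrite in_fsetD negb_and negbK.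
  rewrite !coefs (negbTE nB); case: ifPn => [_ _|jB /= /negP jA].
    by rewrite modulus0 modulus_ge0.
  exact: gA.
- by rewrite !cardfsD fsetIC leq_sub2r.
- move=> n j; rewrite !in_fsetD => /andP[nA nB] /andP[jB jA].
  by rewrite !coefs (negbTE nA) (negbTE jB); apply: gA => //; exact/negP.
- by move=> n; rewrite !in_fsetD coefs => /andP[_ ->].
- move=> n; rewrite !in_fsetD !coefs !negb_and !negbK.
  by case: (n \in A); case: (n \in B).
- move=> n; rewrite !in_fsetD !coefs => + [|/(_ I)//].
  by move=> _ /andP[_ ->].
Qed.

Lemma inf_modulus_le f (A : {fset nat}) j : j \in A ->
  0 <= inf [set modulus (xs n f) | n in [set` A]] <= modulus (xs j f).
Proof.
move=> jA; have jS : [set modulus (xs n f) | n in [set` A]] (modulus (xs j f)).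
  by exists j.
have lb : lbound [set modulus (xs n f) | n in [set` A]] 0.
  by move=> _ [n _ <-]; exact: modulus_ge0.
apply/andP; split; first by apply: lb_le_inf => //; exists (modulus (xs j f)).
by apply: ge_inf => //; exists 0.
Qed.

Lemma coef_restricted_truncation f (A : {fset nat}) n :
  xs n (restricted_truncation x xs f [set` A]) =
  if n \in A then of_real k (inf [set modulus (xs n f) | n in [set` A]]) *
    unit_sign (xs n f) else 0.
Proof.
rewrite /restricted_truncation asboolT; last exact: finite_fset.
rewrite linearZ /= fsbig_finite ?set_fsetK; last exact: finite_fset.
by rewrite coef_lincomb//; case: ifP; rewrite ?mulr0.
Qed.

Lemma modulus_restricted_truncation f (A : {fset nat}) n j : n \in A -> j \in A ->
  modulus (xs n (restricted_truncation x xs f [set` A])) <= modulus (xs j f).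
Proof.
move=> nA jA; rewrite coef_restricted_truncation nA modulusM modulus_unit_sign mulr1.
by have /andP[inf0 infj] := inf_modulus_le f jA; rewrite modulus_of_real.
Qed.

(** For finite [A], take [a], [b] and [s] all equal to [A]: everything is erased and a flat vector
    is put back on [A], at the minimal height that [gs_le] allows. *)
Lemma greedy_reach_restricted_truncation f A : greedy_set xs f A ->
  greedy_reach xs f (restricted_truncation x xs f A).
Proof.
have [fA|nfA] := pselect (finite_set A); last first.
  move=> _; apply: greedy_reach_coef0 => n.
  by rewrite /restricted_truncation asboolF// linear0.
case/finite_fsetP: fA => {}A -> gA.
exists [set` A], A, A; split=> //.
- by left; exact: finite_fset.
- by move=> n j; exact: modulus_restricted_truncation.
- by move=> n nA; rewrite nA.
- by move=> n nA _ nA0; rewrite /= nA0 in nA.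
- by move=> n nA _; rewrite coef_restricted_truncation (negbTE nA).
Qed.

(** The same replacement on a finite [A], but with [a = setT] so that the tail survives. *)
Lemma greedy_reach_truncation f A : greedy_set xs f A ->
  greedy_reach xs f (truncation x xs f A).
Proof.
have [fA|nfA] := pselect (finite_set A); last first.
  by move=> _; apply: greedy_reach_coef0 => n; rewrite /truncation asboolF// linear0.
case/finite_fsetP: fA => {}A -> gA.
have coefT n : xs n (truncation x xs f [set` A]) =
    if n \in A then xs n (restricted_truncation x xs f [set` A]) else xs n f.
  rewrite /truncation asboolT; last exact: finite_fset.
  rewrite linearD linearB /= coef_coord_sum// coef_restricted_truncation.
  by case: ifP; rewrite ?subrr ?addr0 ?subr0 ?add0r.
exists setT, A, A; split=> //.
- by right=> n /(_ I).
- by move=> n j nA jA; rewrite coefT nA; exact: modulus_restricted_truncation.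
- by move=> n nA; rewrite nA.
- by move=> n nA; rewrite coefT (negbTE nA).
- by move=> n nA [nA'|/(_ I)//]; rewrite nA' in nA.
Qed.

(** Nonzero one-term vectors are fixed by the projection and by both truncations on [[set n]],
    whence the lower bound 1 for [C_qg], [Lambda_u] and [Lambda_t]. *)
Lemma greedy_set1 c n : greedy_set xs (c *: x n) [set n].
Proof.
move=> i j /= -> /eqP/negbTE jn; rewrite !linearZ /= !biorth eqxx mulr1.
by rewrite eq_sym jn mulr0 modulus0 modulus_ge0.
Qed.

Lemma coord_sum1 c n : coord_sum x xs [set n] (c *: x n) = c *: x n.
Proof. by rewrite /coord_sum fsbig_set1 linearZ /= biorth eqxx mulr1. Qed.

Lemma restricted_truncation1 c n : c != 0 ->
  restricted_truncation x xs (c *: x n) [set n] = c *: x n.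
Proof.
move=> c0; rewrite /restricted_truncation asboolT// image_set1 inf1 fsbig_set1.
rewrite scalerA linearZ /= biorth eqxx mulr1 of_real_modulus.
by rewrite /unit_sign (negbTE c0) mulrCA divff ?mulr1// normr_eq0.
Qed.

Lemma truncation1 c n : c != 0 ->
  truncation x xs (c *: x n) [set n] = c *: x n.
Proof.
by move=> c0; rewrite /truncation asboolT// restricted_truncation1// coord_sum1 subrr addr0.
Qed.

End Operations.

(** * The renorming and its four constants *)

Theorem corollary11p4 (R : realType) (k : scalar_kind)
    (X : lmodType (scalar_field R k)) (N : X -> R)
    (x : nat -> X) (xs : nat -> {scalar X}) :
  quasi_Banach N ->
  almost_greedy_basis N x xs ->
  exists N' : X -> R,
    [/\ renorming N N',
        is_C_qg N' x xs 1,
        is_C_ag N' x xs 1,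
        Lambda_u N' x xs = 1%:E
      & Lambda_t N' x xs = 1%:E].
Proof.
move=> [qnN _] [[denseN _ biorth] _ _ [C C_ge1 agN]].
have [kappa kappa_ge1 triangleN] := qnorm_triangle qnN.
pose N' f := sup [set N g | g in [set g | greedy_reach xs f g]].
pose D := kappa * (C ^+ 2 * (kappa * (1 + C)) + kappa * (1 + C + C)).
have kappa_gt0 : 0 < kappa by exact: lt_le_trans kappa_ge1.
have C_gt0 : 0 < C by exact: lt_le_trans C_ge1.
have D_gt0 : 0 < D by rewrite mulr_gt0// addr_gt0// ?mulr_gt0 ?addr_gt0 ?exprn_gt0.
have reachN f g : greedy_reach xs f g -> N g <= D * N f.
  by move=> [a [b [s]]]; exact: qnorm_greedy_step.
have ubN f : has_ubound [set N g | g in [set g | greedy_reach xs f g]].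
  by exists (D * N f) => _ [g fg <-]; exact: reachN.
have N'_ge f g : greedy_reach xs f g -> N g <= N' f.
  by move=> fg; apply: ub_le_sup => //; exists g.
have N'_le f r : (forall g, greedy_reach xs f g -> N g <= r) -> N' f <= r.
  move=> fr; apply: ge_sup; first by exists (N f), f => //; exact: greedy_reach_refl.
  by move=> _ [g fg <-]; exact: fr.
have NN' f : N f <= N' f by apply: N'_ge; exact: greedy_reach_refl.
have N'N f : N' f <= D * N f by apply: N'_le => g; exact: reachN.
have N'_mono f g : greedy_reach xs f g -> N' g <= N' f.
  by move=> fg; apply: N'_le => h gh; apply: N'_ge; exact: greedy_reach_trans gh.
have N'_ge0 f : 0 <= N' f by exact: le_trans (qnorm_ge0 qnN f) (NN' f).
have N'0 : N' 0 = 0.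
  by apply/eqP; rewrite eq_le N'_ge0 (le_trans (N'N _))// qnorm0// mulr0.
have N'Z_ge (c : scalar_field R k) f : modulus c * N' f <= N' (c *: f).
  have [->|c0] := eqVneq c 0; first by rewrite modulus0 mul0r.
  have mc := modulus_gt0 c0.
  rewrite mulrC -ler_pdivlMr//; apply: N'_le => g fg.
  by rewrite ler_pdivlMr// mulrC -(qnormZ qnN); apply/N'_ge/greedy_reachZ.
have N'Z (c : scalar_field R k) f : N' (c *: f) = modulus c * N' f.
  apply/eqP; rewrite eq_le N'Z_ge andbT.
  have [->|c0] := eqVneq c 0; first by rewrite scale0r modulus0 mul0r N'0.
  have mc := modulus_gt0 c0.
  (* The reverse inequality is [N'Z_ge] for [c^-1] at the vector [c *: f]. *)
  rewrite -ler_pdivrMl// -modulusV.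
  by rewrite (le_trans (N'Z_ge _ _))// scalerA mulVf// scale1r.
have N'x_gt0 n : 0 < N' (x n).
  rewrite lt_neqAle N'_ge0 andbT; apply/eqP => N'x.
  have x0 : x n = 0.
    apply: (qnorm_eq0 qnN); apply/eqP; rewrite eq_le (qnorm_ge0 qnN) andbT.
    by rewrite [leRHS]N'x NN'.
  by have /eqP := biorth n n; rewrite x0 linear0 eqxx eq_sym oner_eq0.
(* The test vector for the lower bounds, normalized for [N']. *)
have [c c0 N'cx] : exists2 c : scalar_field R k, c != 0 & N' (c *: x 0) = 1.
  have c_ge0 : 0 <= (N' (x 0))^-1 by rewrite invr_ge0.
  exists (of_real k (N' (x 0))^-1).
    apply: contraTneq (N'x_gt0 0) => c0.
    by rewrite -invr_gt0 -(modulus_of_real (k := k) c_ge0) c0 modulus0 ltxx.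
  by rewrite N'Z modulus_of_real// mulVf// gt_eqF.
exists N'; split.
- split.
    split=> //.
      move=> f N'f; apply: (qnorm_eq0 qnN); apply/eqP.
      by rewrite eq_le (qnorm_ge0 qnN) andbT -N'f.
    (* Passing from [N'] to [N], using [kappa] and returning by [N <= N'] costs [D * kappa]; the
       summand 1 makes the constant at least 1. *)
    exists (1 + D * kappa) => [|f g]; first by rewrite lerDl mulr_ge0// ltW.
    rewrite mulrDl (le_trans (N'N _))// -[leLHS]add0r lerD ?mul1r ?addr_ge0//.
    by rewrite -mulrA ler_pM2l// (le_trans (triangleN _ _))// ler_pM2l// lerD.
  by exists 1, D; split=> // f; rewrite mul1r NN' N'N.
- split=> [f A B fA gA gB BA|B bB].
    by rewrite mul1r; apply: N'_mono; exact: greedy_reach_coord_sum.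
  have := bB (c *: x 0) [set 0%N] set0.
  rewrite setD0 coord_sum1// N'cx mulr1; apply=> //.
  exact: greedy_set1.
(* Minimality is built in: [is_C_ag] only admits constants that are at least 1. *)
- split=> [|B []//]; split=> // f A B fA gA BA.
  by rewrite mul1r; apply: N'_mono; exact: greedy_reach_almost_greedy.
- apply/eqP; rewrite eq_le; apply/andP; split.
    apply: ge_ereal_sup => _ [f [A [gA Nf ->]]]; rewrite lee_fin (le_trans _ Nf)//.
    by apply: N'_mono; exact: greedy_reach_restricted_truncation.
  apply: ereal_sup_ubound; exists (c *: x 0), [set 0%N].
  by rewrite restricted_truncation1// N'cx; split=> //; exact: greedy_set1.
- apply/eqP; rewrite eq_le; apply/andP; split.
    apply: ge_ereal_sup => _ [f [A [gA Nf ->]]]; rewrite lee_fin (le_trans _ Nf)//.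
    by apply: N'_mono; exact: greedy_reach_truncation.
  apply: ereal_sup_ubound; exists (c *: x 0), [set 0%N].
  by rewrite truncation1// N'cx; split=> //; exact: greedy_set1.
Qed.
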